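(* Let $ABC$ be a triangle and $P$, $Q$ two points in its plane. (i) Suppose $BP$ intersects $CQ$ in $A_1$, $CP$ intersects $AQ$ in $B_1$, and $AP$ intersects $BQ$ in $C_1$. Then the lines $AA_1$, $BB_1$, $CC_1$ intersect in a point $R$. (ii) If moreover $BQ\cap CP=\{A_2\}$, $CQ\cap AP=\{B_2\}$, $BP\cap AQ=\{C_2\}$, then the triangles $ABC$, $A_1B_1C_1$, $A_2B_2C_2$ are pairwise homological (with corresponding vertices $A,A_1,A_2$; $B,B_1,B_2$; $C,C_1,C_2$), and their three homological centers are collinear.
   Context: Work in the real plane completed with its points at infinity (the real projective plane); concurrency and collinearity are understood there. Two triangles with a given vertex correspondence are homological (perspective) if the three lines joining corresponding vertices are concurrent; the common point is their homological center. General position is understood: $P\neq Q$, neither $P$ nor $Q$ lies on a side line of $ABC$, and $A_1B_1C_1$ and $A_2B_2C_2$ are non-degenerate triangles. *)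

(* Defs.v *)
From mathcomp Require Import all_boot all_order all_algebra.
From mathcomp Require Import reals.

Set Implicit Arguments.
Unset Strict Implicit.
Unset Printing Implicit Defensive.

Import GRing.Theory.
Local Open Scope ring_scope.

(* The completed real plane in homogeneous coordinates: the affine point (x, y)
   is the vector line spanned by (x, y, 1), and the points at infinity are the
   vector lines spanned by some (u, v, 0). *)
Record point (R : realType) := Point {
  point_space :> {vspace 'rV[R]_3};
  dim_point : \dim point_space = 1%N
}.

Record line (R : realType) := Line {
  line_space :> {vspace 'rV[R]_3};
  dim_line : \dim line_space = 2%N
}.

(* Incidence is inclusion of vector subspaces. *)
Definition on (R : realType) (X : point R) (l : {vspace 'rV[R]_3}) : Prop :=
  (X <= l)%VS.

(* This is the line XY only when X <> Y; otherwise it is the point X itself. *)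
Definition join (R : realType) (X Y : point R) : {vspace 'rV[R]_3} :=
  (X + Y)%VS.

(* As point sets, the intersection of l and m is exactly {X}. *)
Definition meets_in (R : realType) (l m : {vspace 'rV[R]_3}) (X : point R)
    : Prop :=
  (l :&: m)%VS = X.

Definition three_meet_in (R : realType) (l m n : {vspace 'rV[R]_3})
    (X : point R) : Prop :=
  (l :&: m :&: n)%VS = X.

Definition collinear (R : realType) (X Y Z : point R) : Prop :=
  exists l : line R, [/\ on X l, on Y l & on Z l].

Definition is_triangle (R : realType) (A B C : point R) : Prop :=
  ~ collinear A B C.

Definition on_side_line (R : realType) (X A B C : point R) : Prop :=
  [\/ on X (join B C), on X (join C A) | on X (join A B)].

(* The inequalities say that the three lines joining corresponding vertices
   are defined. *)
Definition homological_center (R : realType) (A B C A' B' C' O : point R)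
    : Prop :=
  [/\ A <> A', B <> B', C <> C'
    & three_meet_in (join A A') (join B B') (join C C') O].

Definition homological (R : realType) (A B C A' B' C' : point R) : Prop :=
  exists O : point R, homological_center A B C A' B' C' O.

(* Main.v *)
(** In coordinates adapted to [A], [B], [C] with [Q = (1, 1, 1)] and
    [P = (x, y, z)], one finds
      [A1 = (x, x, z)], [B1 = (x, y, y)], [C1 = (z, y, z)],
      [A2 = (x, y, x)], [B2 = (y, y, z)], [C2 = (x, z, z)],
    the centers of [ABC] with the two other triangles are
    [O1 = (xz, xy, yz)] and [O2 = (xy, yz, xz)], and
    [O1 + O2 = y A1 + z A2 = z B1 + x B2 = x C1 + y C2] is the third one.
    Three lines through a common point meet only there unless all three
    coincide, which would put the vertices of a triangle on one line. *)
Require Import Defs.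
From mathcomp Require Import all_boot all_order all_algebra.
From mathcomp Require Import reals.
From mathcomp Require Import ring lra.

Set Implicit Arguments.
Unset Strict Implicit.
Unset Printing Implicit Defensive.

Import GRing.Theory Num.Theory.
Local Open Scope ring_scope.

(** * Subspaces behind points and lines; concurrency of joins *)

Section Points.
Variable R : realType.
Implicit Types (X Y Z O : point R) (U : {vspace 'rV[R]_3}) (u v w : 'rV[R]_3).

(** The dimension field is an equation between naturals, so its proofs are all equal. *)
Lemma point_space_inj : injective (@point_space R).
Proof.
case=> U dU [V dV] /= eUV; rewrite -eUV in dV *.
by rewrite (eq_irrelevance dU dV).
Qed.

Lemma dim_rV3 : \dim {:'rV[R]_3} = 3%N.
Proof. by rewrite dimvf /dim /=. Qed.

Lemma point_vline X : exists2 v, v != 0 & (X : {vspace _}) = <[v]>%VS.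
Proof.
have nz : vpick X != 0 by rewrite vpick0 -dimv_eq0 dim_point.
exists (vpick X) => //; apply/esym/eqP.
by rewrite eqEdim dim_point dim_vline nz -memvE memv_pick.
Qed.

(** Turns a [meets_in] hypothesis into coordinates: one nonzero vector of the intersection already
    spans it. *)
Lemma point_eq_vline X U v :
  v != 0 -> v \in U -> U = X :> {vspace _} -> (X : {vspace _}) = <[v]>%VS.
Proof.
move=> nz vU eU; apply/esym/eqP.
by rewrite eqEdim dim_point dim_vline nz -memvE -eU vU.
Qed.

Definition vpoint v (nz : v != 0) : point R :=
  @Point R <[v]>%VS (etrans (dim_vline v) (congr1 nat_of_bool nz)).

Lemma dim_join X Y : X <> Y -> \dim (join X Y) = 2%N.
Proof.
move=> nXY; rewrite /join dimv_disjoint_sum ?dim_point //.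
apply/eqP; rewrite -dimv_eq0 -leqn0 leqNgt; apply/negP => dXY.
have/eqP eX : (X :&: Y)%VS == X :> {vspace _} by rewrite eqEdim capvSl dim_point.
have/eqP eY : (X :&: Y)%VS == Y :> {vspace _} by rewrite eqEdim capvSr dim_point.
by apply: nXY; apply: point_space_inj; rewrite -eX -{2}eY.
Qed.

(** A basis of [U] followed by a basis of a complement is free; its first two vectors span a plane,
    and they include the whole basis of [U]. Coinciding points are thereby covered in
    [collinear_dim]. *)
Lemma sub_line U : (\dim U <= 2)%N -> exists l : line R, (U <= l)%VS.
Proof.
move=> dU; pose s := vbasis U ++ vbasis U^C%VS.
have dC : (\dim U + \dim U^C = 3)%N by rewrite dimv_compl dim_rV3 subnKC // ltnW.
have fs : free s.
  rewrite cat_free !(basis_free (vbasisP _)) /= !(span_basis (vbasisP _)).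
  by apply/directv_addP; rewrite capv_compl.
have ft : free (take 2 s) by move: fs; rewrite -{1}(cat_take_drop 2 s) => /catl_free.
have dt : \dim <<take 2 s>> = 2%N.
  by rewrite (eqP ft) size_take size_cat !size_tuple dC.
exists (Line dt); rewrite /= -{1}(span_basis (vbasisP U)); apply: sub_span => v vU.
by rewrite take_cat size_tuple ltnNge dU /= mem_cat vU.
Qed.

Lemma collinear_dim X Y Z : (\dim (X + Y + Z) <= 2)%N -> collinear X Y Z.
Proof.
by case/sub_line => l; rewrite !subv_add => /andP[/andP[? ?] ?]; exists l.
Qed.

Lemma triangle_fullv X Y Z : is_triangle X Y Z -> (X + Y + Z = fullv)%VS.
Proof.
move=> tXYZ; apply/eqP; rewrite eqEdim subvf dim_rV3 ltnNge.
by apply/negP => /collinear_dim.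
Qed.

Lemma three_meet_in_joins X Y Z X' Y' Z' O :
  ~ collinear X Y Z -> X <> X' -> Y <> Y' -> Z <> Z' ->
  on O (join X X') -> on O (join Y Y') -> on O (join Z Z') ->
  three_meet_in (join X X') (join Y Y') (join Z Z') O.
Proof.
move=> nXYZ nX nY nZ OX OY OZ.
rewrite /three_meet_in; set U := (_ :&: _)%VS.
have OU : (O <= U)%VS by rewrite !subv_cap OX OY OZ.
apply/esym/eqP; rewrite eqEdim OU dim_point /= leqNgt; apply/negP => dU.
have UX : (U <= join X X')%VS by apply: subv_trans (capvSl _ _) (capvSl _ _).
have UY : (U <= join Y Y')%VS by apply: subv_trans (capvSl _ _) (capvSr _ _).
have UZ : (U <= join Z Z')%VS by apply: capvSr.
(* If the common part [U] has dimension at least 2, it fills each of the three joins, so all of them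
   coincide. *)
have full V W : V <> W -> (U <= join V W)%VS -> U = join V W.
  by move=> /dim_join dVW s; apply/eqP; rewrite eqEdim s dVW.
apply: nXYZ; apply: collinear_dim.
have dUX : (\dim U <= 2)%N by rewrite (full _ _ nX UX) dim_join.
apply: leq_trans dUX; apply: dimvS; rewrite !subv_add.
by rewrite {1}(full _ _ nX UX) {1}(full _ _ nY UY) {1}(full _ _ nZ UZ) !addvSl.
Qed.

End Points.

(** * Homogeneous coordinates relative to a triangle *)

Section Frames.
Variable R : realType.
Implicit Types (A B C P Q : point R) (a b c u v w : 'rV[R]_3).

Definition comb a b c (x y z : R) : 'rV[R]_3 := x *: a + y *: b + z *: c.

Lemma mem_join P Q u v w (s t : R) :
  (P : {vspace _}) = <[u]>%VS -> (Q : {vspace _}) = <[v]>%VS ->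
  w = s *: u + t *: v -> w \in join P Q.
Proof. by move=> eP eQ ->; rewrite /join eP eQ memv_add // memvZ // memv_line. Qed.

(** Three vectors that span a space of dimension 3 are linearly independent. *)
Lemma comb_free A B C a b c (x y z : R) : is_triangle A B C ->
  (A : {vspace _}) = <[a]>%VS -> (B : {vspace _}) = <[b]>%VS ->
  (C : {vspace _}) = <[c]>%VS ->
  comb a b c x y z = 0 -> [/\ x = 0, y = 0 & z = 0].
Proof.
move=> tABC eA eB eC e0.
have f : free [:: a; b; c].
  rewrite /free !span_cons span_nil addv0 -eA -eB -eC addvA.
  by rewrite (triangle_fullv tABC) dim_rV3.
have/freeP/(_ (fun i => [:: x; y; z]`_i)) /= H : free (in_tuple [:: a; b; c]) by [].
have {}H i : [:: x; y; z]`_(i : 'I_3) = 0.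
  by apply: H; rewrite !big_ord_recl big_ord0 /= addr0 addrA.
by split; [apply: (H 0) | apply: (H 1) | apply: (H 2)].
Qed.

Lemma comb_coords A B C P a b c : is_triangle A B C -> ~ on_side_line P A B C ->
  (A : {vspace _}) = <[a]>%VS -> (B : {vspace _}) = <[b]>%VS ->
  (C : {vspace _}) = <[c]>%VS ->
  exists x y z : R, [/\ x != 0, y != 0, z != 0
    & (P : {vspace _}) = <[comb a b c x y z]>%VS].
Proof.
move=> tABC sP eA eB eC; have [p nzp eP] := point_vline P.
have := memvf p; rewrite -(triangle_fullv tABC) eA eB eC.
case/memv_addP => _ /memv_addP[_ /vlineP[x ->] [_ /vlineP[y ->] ->]].
case=> _ /vlineP[z ->] ep; exists x, y, z; rewrite /comb -ep.
(* A vanishing coordinate would put [P] on the side line opposite the corresponding vertex. *)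
split=> //; apply/eqP => e0; apply: sP; rewrite /on_side_line /on eP -memvE.
- by apply: Or31; apply: (mem_join (s := y) (t := z) eB eC); rewrite ep e0 scale0r add0r.
- by apply: Or32; apply: (mem_join (s := z) (t := x) eC eA); rewrite ep e0 scale0r addr0 addrC.
- by apply: Or33; apply: (mem_join (s := x) (t := y) eA eB); rewrite ep e0 scale0r addr0.
Qed.

Lemma vline_scale k v : k != 0 :> R -> (<[k *: v]> = <[v]>)%VS.
Proof.
move=> nz; apply/eqP; rewrite eqEsubv -!memvE memvZ ?memv_line //=.
by rewrite -{1}(scalerK nz v) memvZ // memv_line.
Qed.

Lemma adapted_frame A B C P Q :
  is_triangle A B C -> ~ on_side_line P A B C -> ~ on_side_line Q A B C ->
  exists a b c x y z, [/\ (A : {vspace _}) = <[a]>%VS,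
    (B : {vspace _}) = <[b]>%VS, (C : {vspace _}) = <[c]>%VS,
    (P : {vspace _}) = <[comb a b c x y z]>%VS
    & (Q : {vspace _}) = <[comb a b c 1 1 1]>%VS] /\
    [/\ x != 0, y != 0 & z != 0].
Proof.
move=> tABC sP sQ; have [a _ eA] := point_vline A.
have [b _ eB] := point_vline B; have [c _ eC] := point_vline C.
have [k [l [m [k0 l0 m0 eQ]]]] := comb_coords tABC sQ eA eB eC.
(* Scaling the representatives of the vertices by the nonzero coordinates of [Q] turns those
   coordinates into (1, 1, 1). *)
move: eA eB eC; rewrite -(vline_scale a k0) -(vline_scale b l0) -(vline_scale c m0).
move=> eA eB eC; have [x [y [z [x0 y0 z0 eP]]]] := comb_coords tABC sP eA eB eC.
exists (k *: a), (l *: b), (m *: c), x, y, z; split; split=> //.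
by rewrite eQ /comb !scale1r.
Qed.

Lemma comb_neq0 A B C a b c (x y z : R) : is_triangle A B C ->
  (A : {vspace _}) = <[a]>%VS -> (B : {vspace _}) = <[b]>%VS ->
  (C : {vspace _}) = <[c]>%VS ->
  [|| x != 0, y != 0 | z != 0] -> comb a b c x y z != 0.
Proof.
move=> tABC eA eB eC; apply: contraTneq => e0.
by have [-> -> ->] := comb_free tABC eA eB eC e0; rewrite eqxx.
Qed.

Lemma vline_comb_eq A B C a b c (x y z x' y' z' : R) : is_triangle A B C ->
  (A : {vspace _}) = <[a]>%VS -> (B : {vspace _}) = <[b]>%VS ->
  (C : {vspace _}) = <[c]>%VS ->
  (<[comb a b c x y z]> = <[comb a b c x' y' z']>)%VS ->
  exists k, [/\ x = k * x', y = k * y' & z = k * z'].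
Proof.
move=> tABC eA eB eC e; have := memv_line (comb a b c x y z).
rewrite e => /vlineP[k ek]; exists k.
have [] := @comb_free _ _ _ a b c (x - k * x') (y - k * y') (z - k * z') tABC eA eB eC.
  transitivity (comb a b c x y z - k *: comb a b c x' y' z').
    by apply/rowP => i; rewrite !mxE; ring.
  by rewrite -ek subrr.
by move=> /subr0_eq ? /subr0_eq ? /subr0_eq ?.
Qed.

End Frames.

(** With the coefficients of [mem_join] supplied, every incidence is a vector identity, checked
    entry by entry. *)
Ltac solve_comb := by apply/rowP => i; rewrite !mxE; ring.

Theorem theorem8 (R : realType) (A B C P Q A1 B1 C1 : point R)
    (hABC : is_triangle A B C)
    (hPQ : P <> Q)
    (hP : ~ on_side_line P A B C)
    (hQ : ~ on_side_line Q A B C)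
    (hA1 : meets_in (join B P) (join C Q) A1)
    (hB1 : meets_in (join C P) (join A Q) B1)
    (hC1 : meets_in (join A P) (join B Q) C1)
    (hT1 : is_triangle A1 B1 C1) :
  (exists S : point R,
     [/\ A <> A1, B <> B1, C <> C1
       & three_meet_in (join A A1) (join B B1) (join C C1) S])
  /\
  (forall A2 B2 C2 : point R,
     meets_in (join B Q) (join C P) A2 ->
     meets_in (join C Q) (join A P) B2 ->
     meets_in (join B P) (join A Q) C2 ->
     is_triangle A2 B2 C2 ->
     [/\ homological A B C A1 B1 C1,
         homological A B C A2 B2 C2,
         homological A1 B1 C1 A2 B2 C2
       & forall O1 O2 O3 : point R,
           homological_center A B C A1 B1 C1 O1 ->
           homological_center A B C A2 B2 C2 O2 ->
           homological_center A1 B1 C1 A2 B2 C2 O3 ->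
           collinear O1 O2 O3]).
Proof.
have [a [b [c [x [y [z [[eA eB eC eP eQ] [x0 y0 z0]]]]]]]] := adapted_frame hABC hP hQ.
have nz x' y' z' := comb_neq0 (x := x') (y := y') (z := z') hABC eA eB eC.
have comb_prop x1 y1 z1 x2 y2 z2 := @vline_comb_eq _ _ _ _ a b c x1 y1 z1 x2 y2 z2 hABC eA eB eC.
have cA : a = comb a b c 1 0 0 by solve_comb.
have cB : b = comb a b c 0 1 0 by solve_comb.
have cC : c = comb a b c 0 0 1 by solve_comb.
have memj X Y u v s t w := @mem_join R X Y u v w s t.
have eA1 : (A1 : {vspace _}) = <[comb a b c x x z]>%VS.
  (* Adding a multiple of [b] to P = (x, y, z) changes only the second coordinate, and points of CQ
     have equal first and second coordinates; this forces (x, x, z). The other intersections are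
     found likewise. *)
  apply: point_eq_vline hA1; rewrite ?nz ?x0 // memv_cap; apply/andP; split.
    by apply: (memj _ _ _ _ (x - y) 1 _ eB eP); solve_comb.
  by apply: (memj _ _ _ _ (z - x) x _ eC eQ); solve_comb.
have eB1 : (B1 : {vspace _}) = <[comb a b c x y y]>%VS.
  apply: point_eq_vline hB1; rewrite ?nz ?x0 // memv_cap; apply/andP; split.
    by apply: (memj _ _ _ _ (y - z) 1 _ eC eP); solve_comb.
  by apply: (memj _ _ _ _ (x - y) y _ eA eQ); solve_comb.
have eC1 : (C1 : {vspace _}) = <[comb a b c z y z]>%VS.
  apply: point_eq_vline hC1; rewrite ?nz ?z0 // memv_cap; apply/andP; split.
    by apply: (memj _ _ _ _ (z - x) 1 _ eA eP); solve_comb.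
  by apply: (memj _ _ _ _ (y - z) z _ eB eQ); solve_comb.
(* One nonzero coordinate where the vertex has 0 suffices to tell a point from that vertex. *)
have nAv (X : point R) u v w : (X : {vspace _}) = <[comb a b c u v w]>%VS -> v != 0 -> A <> X.
  move=> eX v0 eAX; move: eX; rewrite -eAX eA {1}cA => /esym/comb_prop[k [_ ev _]].
  by move: v0; rewrite ev mulr0 eqxx.
have nBw (X : point R) u v w : (X : {vspace _}) = <[comb a b c u v w]>%VS -> w != 0 -> B <> X.
  move=> eX w0 eBX; move: eX; rewrite -eBX eB {1}cB => /esym/comb_prop[k [_ _ ew]].
  by move: w0; rewrite ew mulr0 eqxx.
have nCu (X : point R) u v w : (X : {vspace _}) = <[comb a b c u v w]>%VS -> u != 0 -> C <> X.
  move=> eX u0 eCX; move: eX; rewrite -eCX eC {1}cC => /esym/comb_prop[k [eu _ _]].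
  by move: u0; rewrite eu mulr0 eqxx.
have [nA1 nB1 nC1] : [/\ A <> A1, B <> B1 & C <> C1].
  by split; [apply: nAv eA1 x0 | apply: nBw eB1 y0 | apply: nCu eC1 z0].
pose o1 := comb a b c (x * z) (x * y) (y * z).
have o1nz : o1 != 0 by rewrite nz // mulf_neq0.
have o1A : o1 \in join A A1.
  (* The vector y A1 = (xy, xy, yz) agrees with [o1] except in the first coordinate, which a
     multiple of [a] corrects. *)
  by apply: (memj _ _ _ _ (x * z - x * y) y _ eA eA1); solve_comb.
have o1B : o1 \in join B B1.
  by apply: (memj _ _ _ _ (x * y - y * z) z _ eB eB1); solve_comb.
have o1C : o1 \in join C C1.
  by apply: (memj _ _ _ _ (y * z - x * z) x _ eC eC1); solve_comb.
have H1 : homological_center A B C A1 B1 C1 (vpoint o1nz).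
  by split=> //; apply: three_meet_in_joins => //; rewrite /on -memvE.
split; first by exists (vpoint o1nz).

(* The second triple of intersections and the remaining two centers *)
move=> A2 B2 C2 hA2 hB2 hC2 _.
have eA2 : (A2 : {vspace _}) = <[comb a b c x y x]>%VS.
  apply: point_eq_vline hA2; rewrite ?nz ?x0 // memv_cap; apply/andP; split.
    by apply: (memj _ _ _ _ (y - x) x _ eB eQ); solve_comb.
  by apply: (memj _ _ _ _ (x - z) 1 _ eC eP); solve_comb.
have eB2 : (B2 : {vspace _}) = <[comb a b c y y z]>%VS.
  apply: point_eq_vline hB2; rewrite ?nz ?y0 // memv_cap; apply/andP; split.
    by apply: (memj _ _ _ _ (z - y) y _ eC eQ); solve_comb.
  by apply: (memj _ _ _ _ (y - x) 1 _ eA eP); solve_comb.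
have eC2 : (C2 : {vspace _}) = <[comb a b c x z z]>%VS.
  apply: point_eq_vline hC2; rewrite ?nz ?x0 // memv_cap; apply/andP; split.
    by apply: (memj _ _ _ _ (z - y) 1 _ eB eP); solve_comb.
  by apply: (memj _ _ _ _ (x - z) z _ eA eQ); solve_comb.
have [nA2 nB2 nC2] : [/\ A <> A2, B <> B2 & C <> C2].
  by split; [apply: nAv eA2 y0 | apply: nBw eB2 z0 | apply: nCu eC2 x0].
pose o2 := comb a b c (x * y) (y * z) (x * z).
have o2nz : o2 != 0 by rewrite nz // mulf_neq0.
have o2A : o2 \in join A A2.
  by apply: (memj _ _ _ _ (x * y - x * z) z _ eA eA2); solve_comb.
have o2B : o2 \in join B B2.
  by apply: (memj _ _ _ _ (y * z - x * y) x _ eB eB2); solve_comb.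
have o2C : o2 \in join C C2.
  by apply: (memj _ _ _ _ (x * z - y * z) y _ eC eC2); solve_comb.
have H2 : homological_center A B C A2 B2 C2 (vpoint o2nz).
  by split=> //; apply: three_meet_in_joins => //; rewrite /on -memvE.
(* Equal coordinates would make [P] proportional to (1, 1, 1), that is, equal to [Q]. *)
have nxyz : ~ (x = y /\ y = z).
  case=> exy eyz; apply: hPQ; apply: point_space_inj.
  rewrite eP eQ -(vline_scale (comb a b c 1 1 1) x0) -eyz -exy; congr (<[_]>%VS).
  solve_comb.
have k1 (k u : R) : u != 0 -> u = k * u -> k = 1 by move=> u0 e; apply: (mulIf u0); rewrite mul1r.
(* The vectors (x, x, z) and (x, y, x) share a nonzero first coordinate, so proportionality has
   factor 1 and gives x = y = z. The pairs for [B] and [C] share the second and third coordinate. *)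
have n12A : A1 <> A2.
  move=> e; move: eA2; rewrite -e eA1 => /comb_prop[k [/(k1 _ _ x0)-> exy ezx]].
  by apply: nxyz; move: exy ezx; rewrite !mul1r => <- ->.
have n12B : B1 <> B2.
  move=> e; move: eB2; rewrite -e eB1 => /comb_prop[k [exy /(k1 _ _ y0) ek eyz]].
  by apply: nxyz; move: exy eyz; rewrite ek !mul1r.
have n12C : C1 <> C2.
  move=> e; move: eC2; rewrite -e eC1 => /comb_prop[k [ezx eyz /(k1 _ _ z0) ek]].
  by apply: nxyz; move: ezx eyz; rewrite ek !mul1r => <- ->.
have o3E : o1 + o2 = comb a b c (x * (y + z)) (y * (z + x)) (z * (x + y)) by solve_comb.
have o3nz : o1 + o2 != 0.
  (* If all three coordinates vanished, the sums y + z, z + x and x + y would be 0, whence x = 0. *)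
  rewrite o3E nz // !mulf_eq0 !(negPf x0, negPf y0, negPf z0) /=.
  apply: contraNT x0; rewrite !negb_or !negbK => /and3P[/eqP ? /eqP ? /eqP ?].
  by apply/eqP; lra.
have o3A : o1 + o2 \in join A1 A2.
  by apply: (memj _ _ _ _ y z _ eA1 eA2); solve_comb.
have o3B : o1 + o2 \in join B1 B2.
  by apply: (memj _ _ _ _ z x _ eB1 eB2); solve_comb.
have o3C : o1 + o2 \in join C1 C2.
  by apply: (memj _ _ _ _ x y _ eC1 eC2); solve_comb.
have H3 : homological_center A1 B1 C1 A2 B2 C2 (vpoint o3nz).
  (* Here the non-collinearity of [A1], [B1], [C1] keeps the three joins from coinciding. *)
  by split=> //; apply: three_meet_in_joins => //; rewrite /on -memvE.
split; [by exists (vpoint o1nz) | by exists (vpoint o2nz) | by exists (vpoint o3nz) |].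
move=> O1 O2 O3 [_ _ _ e1] [_ _ _ e2] [_ _ _ e3].
(* Any center equals the intersection of its joins, hence the center built above; the third one lies
   in the span of [o1] and [o2]. *)
apply: collinear_dim; rewrite -e1 -e2 -e3.
case: H1 => _ _ _ ->; case: H2 => _ _ _ ->; case: H3 => _ _ _ -> /=.
have/addv_idPl -> : (<[o1 + o2]> <= <[o1]> + <[o2]>)%VS.
  by rewrite -memvE memv_add // memv_line.
by apply: leq_trans (dimv_add_leqif _ _) _; rewrite !dim_vline o1nz o2nz.
Qed.
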